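(* Let $d\ge2$, $\kappa\in\mathbb R\setminus\{0\}$ and let $P=[-\tau_1^-,\tau_1^+]\times\cdots\times[-\tau_d^-,\tau_d^+]$ for some $\tau_1^-,\ldots,\tau_d^->0$ and $\tau_1^+,\ldots,\tau_d^+>0$. Assume that $P\subseteq\bar{\mathbb B}^d(\kappa)$. Then the Riemannian volume of $P$ is given by $$\operatorname{Vol}_{d,\kappa}(P)=\frac{\omega_{d+1}}{\kappa^{d/2}\sqrt{2\pi}}\int_0^\infty\prod_{j=1}^d\left(\Phi\left(\tau_j^+\sqrt\kappa\,z\right)-\Phi\left(-\tau_j^-\sqrt\kappa\,z\right)\right)e^{-z^2/2}\,dz,$$ where $\omega_{d+1}=\frac{2\pi^{(d+1)/2}}{\Gamma((d+1)/2)}$ and, for $\kappa<0$, $\kappa^{d/2}:=(\sqrt\kappa)^d=\mathrm i^d(-\kappa)^{d/2}$.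
   Context: $\mathbb B^d(\kappa):=\mathbb R^d$ if $\kappa\ge0$ and $\mathbb B^d(\kappa):=\{x\in\mathbb R^d:\|x\|<1/\sqrt{-\kappa}\}$ if $\kappa<0$ (Klein model of the space of constant curvature $\kappa$); $\bar{\mathbb B}^d(\kappa)$ is its Euclidean closure. The Riemannian volume of a Borel set $B\subseteq\bar{\mathbb B}^d(\kappa)$ is $$\operatorname{Vol}_{d,\kappa}(B)=\int_{B\cap\mathbb B^d(\kappa)}\frac{dy_1\cdots dy_d}{(1+\kappa\|y\|^2)^{(d+1)/2}}\in[0,+\infty].$$ $\Phi$ is the entire function $\Phi(z)=\frac12+\frac1{\sqrt{2\pi}}\int_0^z e^{-t^2/2}\,dt$, $z\in\mathbb C$. Convention: $\sqrt{-a}:=\mathrm i\sqrt a$ for $a>0$. *)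

(* Defs.v *)
From HB Require Import structures.
From mathcomp Require Import all_boot all_order all_algebra.
From mathcomp Require Import all_classical all_reals all_analysis.
From mathcomp Require Import complex.

Set Implicit Arguments.
Unset Strict Implicit.
Unset Printing Implicit Defensive.

Import Order.TTheory GRing.Theory Num.Theory.
Import numFieldNormedType.Exports.

Local Open Scope classical_set_scope.
Local Open Scope ring_scope.
Local Open Scope complex_scope.

(* The sigma-algebra generated by the coordinates, as for [n.-tuple] in the
   library. *)
Section measurable_rV.
Context {R : realType} {n : nat}.

Let coors : 'I_n -> 'rV[R]_n -> R := fun i x => x ord0 i.

Let rV_set0 : g_sigma_preimage coors set0.
Proof. exact: sigma_algebra0. Qed.

Let rV_setC A : g_sigma_preimage coors A -> g_sigma_preimage coors (~` A).
Proof. exact: sigma_algebraC. Qed.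

Let rV_bigcup (F : _^nat) : (forall i, g_sigma_preimage coors (F i)) ->
  g_sigma_preimage coors (\bigcup_i (F i)).
Proof. exact: sigma_algebra_bigcup. Qed.

HB.instance Definition _ := @isMeasurable.Build default_measure_display
  'rV[R]_n (g_sigma_preimage coors) rV_set0 rV_setC rV_bigcup.

Lemma measurable_rV_coord (i : 'I_n) :
  measurable_fun [set: 'rV[R]_n] (fun x => x ord0 i).
Proof.
move=> _ Y mY; rewrite setTI; apply: sub_sigma_algebra => /=.
rewrite -bigcup_seq/=; exists i => /=; first by rewrite mem_index_enum.
by exists Y => //; rewrite setTI.
Qed.

Lemma measurable_fun_rV d (T : measurableType d) (f : T -> 'rV[R]_n) :
  (forall i, measurable_fun [set: T] (fun x => f x ord0 i)) ->
  measurable_fun [set: T] f.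
Proof.
move=> mf _ A mA.
suff : g_sigma_preimage coors `<=`
    [set B | measurable ([set: T] `&` f @^-1` B)] by exact.
apply: smallest_sub.
  split => /=.
  - by rewrite preimage_set0 setI0.
  - move=> B mB; rewrite setTD -preimage_setC setTI.
    by move: mB; rewrite setTI => /measurableC.
  - move=> F mF; rewrite preimage_bigcup setI_bigcupr.
    exact: bigcupT_measurable.
rewrite -bigcup_seq; apply: bigcup_sub => i _ _ [B mB <-] /=.
by rewrite setTI; exact: mf.
Qed.

End measurable_rV.

Section lebesgue_rV.
Context {R : realType}.
Local Open Scope ereal_scope.

Section step.
Context {n : nat} (mu : {sigma_finite_measure set 'rV[R]_n -> \bar R}).

Definition rV_cons (p : R * 'rV[R]_n) : 'rV[R]_n.+1 := row_mx p.1%:M p.2.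

Lemma rV_cons0 p : rV_cons p ord0 ord0 = p.1.
Proof.
transitivity (rV_cons p ord0 (@lshift 1 n ord0)).
  by congr (rV_cons p _ _); exact: val_inj.
by rewrite [LHS](@row_mxEl _ 1 1 n) mxE.
Qed.

Lemma rV_consS p i : rV_cons p ord0 (lift ord0 i) = p.2 ord0 i.
Proof.
transitivity (rV_cons p ord0 (@rshift 1 n i)).
  by congr (rV_cons p _ _); exact: val_inj.
exact: (@row_mxEr _ 1 1 n).
Qed.

Lemma measurable_rV_cons : measurable_fun setT rV_cons.
Proof.
apply: measurable_fun_rV => i.
have [j ->|->] := unliftP ord0 i.
  rewrite (_ : (fun _ => _) = (fun v : 'rV[R]_n => v ord0 j) \o snd).
    by apply: measurableT_comp => //; exact: measurable_rV_coord.
  by apply/funext => p /=; rewrite rV_consS.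
rewrite (_ : (fun _ => _) = fst) //.
by apply/funext => p /=; rewrite rV_cons0.
Qed.

Definition lebesgue_rV_step : set 'rV[R]_n.+1 -> \bar R :=
  pushforward (@lebesgue_measure R \x mu) rV_cons.

Let step0 : lebesgue_rV_step set0 = 0.
Proof. by rewrite /lebesgue_rV_step /pushforward preimage_set0 measure0. Qed.

Let step_ge0 A : 0 <= lebesgue_rV_step A.
Proof. by rewrite /lebesgue_rV_step /pushforward; exact: measure_ge0. Qed.

Let step_sigma_additive : semi_sigma_additive lebesgue_rV_step.
Proof.
move=> F mF tF mUF; rewrite /lebesgue_rV_step /pushforward preimage_bigcup.
apply: measure_semi_sigma_additive.
- move=> k; rewrite -[X in measurable X]setTI.
  exact: measurable_rV_cons.
- apply/trivIsetP => /= i j _ _ ij; rewrite -preimage_setI.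
  by move/trivIsetP : tF => /(_ _ _ _ _ ij) ->//; rewrite preimage_set0.
- rewrite -preimage_bigcup -[X in measurable X]setTI.
  exact: measurable_rV_cons.
Qed.

HB.instance Definition _ := isMeasure.Build _ _ _ lebesgue_rV_step
  step0 step_ge0 step_sigma_additive.

Definition rV_uncons (v : 'rV[R]_n.+1) : R * 'rV[R]_n :=
  (v ord0 ord0, \row_i v ord0 (lift ord0 i)).

Lemma rV_consK : cancel rV_cons rV_uncons.
Proof.
move=> [x v]; rewrite /rV_uncons rV_cons0; congr pair.
by apply/rowP => i; rewrite mxE rV_consS.
Qed.

Lemma measurable_rV_uncons : measurable_fun setT rV_uncons.
Proof.
apply/measurable_fun_pair; first exact: measurable_rV_coord.
apply: measurable_fun_rV => i.
under eq_fun do rewrite mxE.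
exact: measurable_rV_coord.
Qed.

(* Proved by hand: the sigma-finite instance of [\x] found by unification is the
   one for products of sub-probabilities. *)
Let step_sigma_finite : sigma_finite setT lebesgue_rV_step.
Proof.
have /sigma_finiteP[F [TF ndF mF]] := sigma_finiteT (@lebesgue_measure R).
have /sigma_finiteP[G [TG ndG mG]] := sigma_finiteT mu.
exists (fun k => rV_uncons @^-1` (F k `*` G k)).
  apply/seteqP; split => // v _.
  have [i _ Fi] : (\bigcup_i F i) (rV_uncons v).1 by rewrite -TF.
  have [j _ Gj] : (\bigcup_i G i) (rV_uncons v).2 by rewrite -TG.
  exists (maxn i j) => //; split.
  - by move: Fi; exact/subsetPset/ndF/leq_maxl.
  - by move: Gj; exact/subsetPset/ndG/leq_maxr.
move=> k; have [mFk Fk] := mF k; have [mGk Gk] := mG k; split.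
  rewrite -[X in measurable X]setTI.
  by apply: measurable_rV_uncons => //; exact: measurableX.
rewrite /lebesgue_rV_step /pushforward -comp_preimage.
rewrite (_ : _ \o _ = id); last by apply/funext => p /=; exact: rV_consK.
by rewrite preimage_id product_measure1E// lte_mul_pinfty// ge0_fin_numE.
Qed.

HB.instance Definition _ := Measure_isSigmaFinite.Build _ _ _ lebesgue_rV_step
  step_sigma_finite.

End step.

Fixpoint lebesgue_rV n : {sigma_finite_measure set 'rV[R]_n -> \bar R} :=
  if n is m.+1 then lebesgue_rV_step (lebesgue_rV m)
  else \d_(0%R : 'rV[R]_0).

Definition box n (a b : 'I_n -> R) : set 'rV[R]_n :=
  [set x | forall i, (a i <= x ord0 i <= b i)%R].

Lemma measurable_box n (a b : 'I_n -> R) : measurable (box a b).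
Proof.
rewrite (_ : box a b = \bigcap_(i in [set: 'I_n])
    ([set: 'rV[R]_n] `&` (fun x => x ord0 i) @^-1` `[a i, b i])).
  apply: fin_bigcap_measurable; first exact: finite_finset.
  by move=> i _; exact: measurable_rV_coord.
apply/seteqP; split => x /= xab i; first by move=> _; split; rewrite //= in_itv /= xab.
by have [_] := xab i I; rewrite /= in_itv.
Qed.

Lemma lebesgue_rV_box n (a b : 'I_n -> R) : (forall i, (a i <= b i)%R) ->
  lebesgue_rV n (box a b) = (\prod_i (b i - a i))%:E.
Proof.
elim: n a b => [|n IH] a b ab.
  rewrite big_ord0 /= diracE mem_set//.
  by move=> [].
rewrite big_ord_recl /= /lebesgue_rV_step /pushforward.
rewrite (_ : _ @^-1` _ = `[a ord0, b ord0] `*`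
    box (fun i => a (lift ord0 i)) (fun i => b (lift ord0 i))); last first.
  apply/seteqP; split => [p /= pab|p /= [p1 p2] i].
    split; first by have := pab ord0; rewrite rV_cons0 in_itv.
    by move=> i; have := pab (lift ord0 i); rewrite rV_consS.
  have [j ->|->] := unliftP ord0 i; first by rewrite rV_consS.
  by rewrite rV_cons0; move: p1; rewrite in_itv.
rewrite product_measure1E//; last exact: measurable_box.
rewrite IH// EFinM; congr mule.
transitivity (@lebesgue_measure R `[a ord0, b ord0]) => //.
rewrite lebesgue_measure_itv/= lte_fin.
have := ab ord0; rewrite le_eqVlt => /orP[/eqP->|->]; last by rewrite EFinB.
by rewrite ltxx subrr.
Qed.

End lebesgue_rV.

Section klein.
Context {R : realType}.

Definition enorm n (x : 'rV[R]_n) : R := Num.sqrt (\sum_i x ord0 i ^+ 2).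

Definition klein n (k : R) : set 'rV[R]_n :=
  if 0 <= k then setT else [set x | enorm x < (Num.sqrt (- k))^-1].

(* The topology of ['rV[R]_n] comes from the sup norm, hence is the Euclidean
   one. *)
Definition klein_closure n (k : R) : set 'rV[R]_n := closure (klein k : set 'rV[R]_n).

Definition Vol n (k : R) (B : set 'rV[R]_n) : \bar R :=
  (\int[lebesgue_rV n]_(y in B `&` klein k)
    (((1 + k * enorm y ^+ 2) `^ (n.+1%:R / 2))^-1)%:E)%E.

End klein.

Section complex_functions.
Context {R : realType}.

Definition cexp (z : R[i]) : R[i] :=
  (expR (complex.Re z))%:C * (cos (complex.Im z) +i* sin (complex.Im z)).

Definition cintegrable (D : set R) (f : R -> R[i]) : Prop :=
  (@lebesgue_measure R).-integrable D (EFin \o (fun t => complex.Re (f t))) /\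
  (@lebesgue_measure R).-integrable D (EFin \o (fun t => complex.Im (f t))).

(* Junk-valued unless [cintegrable D f]: a divergent real or imaginary part is
   read as 0. *)
Definition cintegral (D : set R) (f : R -> R[i]) : R[i] :=
  (\int[@lebesgue_measure R]_(t in D) complex.Re (f t)) +i*
  (\int[@lebesgue_measure R]_(t in D) complex.Im (f t)).

(* The integrand being entire, the integral from 0 to z does not depend on the
   path; it is taken along the segment [t = s z], [0 <= s <= 1]. *)
Definition Phi (z : R[i]) : R[i] :=
  2^-1 + ((Num.sqrt (2 * pi))^-1)%:C *
    (z * cintegral `[0, 1] (fun s => cexp (- (s%:C * z) ^+ 2 / 2))).

Definition csqrt (a : R) : R[i] :=
  if 0 <= a then (Num.sqrt a)%:C else 0 +i* Num.sqrt (- a).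

Definition Gamma (x : R) : R :=
  \int[@lebesgue_measure R]_(t in `]0, +oo[) (t `^ (x - 1) * expR (- t)).

Definition omega (n : nat) : R := 2 * pi `^ (n%:R / 2) / Gamma (n%:R / 2).

End complex_functions.

(* Main.v *)
Require Import Defs.
From HB Require Import structures.
From mathcomp Require Import all_boot all_order all_algebra.
From mathcomp Require Import all_classical all_reals all_analysis.
From mathcomp Require Import complex.
From mathcomp Require Import measurable_realfun ring lra.

(** The key identity is the Laplace-type representation of the volume density: for
    [a > 0], the integral over [0, +oo[ of [z ^+ d * expR (- a * z ^+ 2 / 2)] is
    [a] to the power [- (d + 1) / 2] times a moment of the Gaussian
    ([gauss_moment_scale]), and this moment is a value of the Gamma function
    ([Gamma_gauss_moment]). Take [a = 1 + kappa * |y|^2], integrate over [y] in the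
    box and exchange the integrals: for fixed [z] the remaining integrand
    [expR (- kappa * z ^+ 2 * |y|^2 / 2)] is a product over the coordinates, so
    that the integral over the box is a product of one-dimensional Gaussian
    integrals over the segments [[- tm j, tp j]]. This gives
    [integral_slab_product].

    Each of these segment integrals is, up to the factor
    [csqrt kappa * z / sqrt (2 * pi)], the difference of two values of [Phi]. Since
    [csqrt kappa ^+ 2] is the real number [kappa], this holds for both signs of the
    curvature, and the complex integrand of the theorem is [csqrt kappa ^+ d] times
    a nonnegative real function ([Phi_diff_gauss_slab]).

    Everything being nonnegative, Tonelli needs no integrability, but two points
    remain. The representation of the density needs [a > 0], which for negative
    curvature may fail where the box touches the boundary of the ball; this is a
    null set ([box_minus_klein_null]). And the common value has to be finite: in the
    worst case, when a vertex lies on the boundary, each segment integral, times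
    [z], is at most of order [expR (- kappa * m ^+ 2 * z ^+ 2 / 2) / z], with [m] the
    corresponding coordinate of the vertex, so the product, times
    [expR (- z ^+ 2 / 2)], is at most of order [z ^- d] at infinity, integrable for
    [d >= 2] ([slab_product_le]). *)

Set Implicit Arguments.
Unset Strict Implicit.
Unset Printing Implicit Defensive.

Import Order.TTheory GRing.Theory Num.Theory.
Import numFieldNormedType.Exports.

Local Open Scope classical_set_scope.
Local Open Scope ring_scope.
Local Open Scope complex_scope.

(** * Integration on row vectors *)

Lemma measurable_fun_prodr d (T : measurableType d) (R : realType) n
    (h : 'I_n -> T -> R) :
  (forall i, measurable_fun setT (h i)) ->
  measurable_fun setT (fun x => \prod_(i < n) h i x).
Proof.
elim: n h => [|n IH] h mh.
  by under eq_fun do rewrite big_ord0; exact: measurable_cst.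
under eq_fun do rewrite big_ord_recl.
by apply: measurable_funM => //; apply: IH => i; exact: mh.
Qed.

Lemma measurable_fun_EFin d (T : measurableType d) (R : realType)
    (h : T -> R) :
  measurable_fun setT h -> measurable_fun setT (fun x => (h x)%:E).
Proof. by move=> mh; apply: measurableT_comp. Qed.

(** Tonelli along the recursive construction of [lebesgue_rV]: adding a
    coordinate multiplies the integral by one more one-dimensional factor. *)
Lemma integral_rV_prod (R : realType) n (f : 'I_n -> R -> R) :
  (forall i, measurable_fun setT (f i)) -> (forall i x, 0 <= f i x) ->
  (\int[lebesgue_rV n]_y (\prod_(i < n) f i (y ord0 i))%:E =
   \prod_(i < n) \int[@lebesgue_measure R]_s (f i s)%:E)%E.
Proof.
elim: n f => [|n IH] f mf f0.
  rewrite /= integral_dirac//; last first.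
    by under eq_fun do rewrite big_ord0; exact: measurable_cst.
  by rewrite diracE in_setT mul1e !big_ord0.
rewrite big_ord_recl /= -IH//.
have mF : measurable_fun setT
    (fun y : 'rV[R]_n.+1 => \prod_(i < n.+1) f i (y ord0 i)).
  apply: measurable_fun_prodr => i; apply: measurableT_comp => //.
  exact: measurable_rV_coord.
have mF' : measurable_fun setT
    (fun y : 'rV[R]_n => \prod_(i < n) f (lift ord0 i) (y ord0 i)).
  apply: measurable_fun_prodr => i; apply: measurableT_comp => //.
  exact: measurable_rV_coord.
transitivity (\int[pushforward (@lebesgue_measure R \x lebesgue_rV n)
    (@rV_cons R n)]_y (\prod_(i < n.+1) f i (y ord0 i))%:E)%E; first by [].
rewrite ge0_integral_pushforward//=; last 3 first.
- exact: measurable_rV_cons.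
- exact: measurable_fun_EFin.
- by move=> y _; rewrite lee_fin prodr_ge0.
rewrite preimage_setT fubini_tonelli1//=; last 2 first.
- apply: measurable_fun_EFin; apply: (measurableT_comp mF).
  exact: measurable_rV_cons.
- by move=> x; rewrite lee_fin prodr_ge0.
rewrite -ge0_integralZr//; last 3 first.
- exact: (measurable_fun_EFin (mf ord0)).
- by move=> x _; rewrite lee_fin.
- by apply: integral_ge0 => y _; rewrite lee_fin prodr_ge0.
apply: eq_integral => x _; rewrite /fubini_F/= -ge0_integralZl//; last 3 first.
- exact: measurable_fun_EFin.
- by move=> y _; rewrite lee_fin prodr_ge0.
- by rewrite lee_fin.
apply: eq_integral => y _; rewrite big_ord_recl -EFinM rV_cons0/=.
by under eq_bigr do rewrite rV_consS.
Qed.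

(** The indicator function of a box is itself a product of functions of one
    coordinate, so the product formula on the whole space localizes. *)
Lemma integral_box_prod (R : realType) n (a b : 'I_n -> R)
    (f : 'I_n -> R -> R) :
  (forall i, measurable_fun setT (f i)) -> (forall i x, 0 <= f i x) ->
  (\int[lebesgue_rV n]_(y in box a b) (\prod_(i < n) f i (y ord0 i))%:E =
   \prod_(i < n) \int[@lebesgue_measure R]_(s in `[a i, b i]) (f i s)%:E)%E.
Proof.
move=> mf f0; pose g i := f i \_ `[a i, b i].
transitivity (\int[lebesgue_rV n]_y (\prod_(i < n) g i (y ord0 i))%:E)%E.
  rewrite integral_mkcond; apply: eq_integral => y _; rewrite patchE.
  case: ifPn => [/set_mem yab|/negP yab].
    congr (_%:E); apply: eq_bigr => i _.
    by rewrite /g patchE mem_set//= in_itv/=; exact: yab.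
  have [i /negP yi] : exists i, ~~ (a i <= y ord0 i <= b i).
    apply/existsP; rewrite -negb_forall; apply/negP => /forallP H.
    by apply: yab; apply/mem_set => i; exact: H.
  rewrite (bigD1 i)//= /g patchE memNset ?mul0r//.
rewrite integral_rV_prod.
- apply: eq_bigr => i _; rewrite [RHS]integral_mkcond.
  apply: eq_integral => s _; rewrite /g !patchE.
  by case: ifP.
- move=> i; apply/(measurable_restrictT _ _).1 => //.
  by apply: measurable_funTS; exact: mf.
- by move=> i x; rewrite /g patchE; case: ifP.
Qed.

(** Cutting the integrand off outside [A `*` B] reduces an exchange of the two
    integrals over subsets to the exchange on whole spaces. *)
Lemma fubini_tonelli_in d1 d2 (T1 : measurableType d1) (T2 : measurableType d2)
    (R : realType) (m1 : {sigma_finite_measure set T1 -> \bar R})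
    (m2 : {sigma_finite_measure set T2 -> \bar R})
    (A : set T1) (B : set T2) (f : T1 * T2 -> \bar R) :
  measurable A -> measurable B -> measurable_fun setT f ->
  (forall p, 0 <= f p)%E ->
  (\int[m1]_(x in A) \int[m2]_(y in B) f (x, y) =
   \int[m2]_(y in B) \int[m1]_(x in A) f (x, y))%E.
Proof.
move=> mA mB mf f0; pose g := f \_ (A `*` B).
have mg : measurable_fun setT g.
  apply/(measurable_restrictT _ _).1; first exact: measurableX.
  exact: measurable_funTS.
have g0 p : (0 <= g p)%E by rewrite /g patchE; case: ifP.
transitivity (\int[m1]_x \int[m2]_y g (x, y))%E.
  rewrite integral_mkcond; apply: eq_integral => x _.
  rewrite patchE; case: ifPn => xA.
    rewrite integral_mkcond; apply: eq_integral => y _.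
    by rewrite /g !patchE in_setX/= xA.
  by rewrite integral0_eq// => y _; rewrite /g patchE in_setX/= (negbTE xA).
transitivity (\int[m2]_y \int[m1]_x g (x, y))%E; first exact: fubini_tonelli.
rewrite [RHS]integral_mkcond; apply: eq_integral => y _.
rewrite patchE; case: ifPn => yB.
  rewrite [RHS]integral_mkcond; apply: eq_integral => x _.
  by rewrite /g !patchE in_setX/= yB andbT.
by rewrite integral0_eq// => x _; rewrite /g patchE in_setX/= (negbTE yB) andbF.
Qed.

(** * Changes of variables *)

Lemma is_derive_derive1 (R : realType) (F f : R -> R) :
  (forall x, is_derive x (1 : R) F (f x)) -> derive1 F = f.
Proof. by move=> dF; apply/funext => x; rewrite derive1E derive_val. Qed.

Lemma substitution_0b (R : realType) (F f G : R -> R) (b : R) :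
  0 <= b ->
  (forall x, is_derive x (1 : R) F (f x)) -> continuous f -> continuous G ->
  {in `[0, +oo[ &, {homo F : x y / x < y}} ->
  (\int[@lebesgue_measure R]_(x in `[F 0%R, F b]) (G x)%:E =
   \int[@lebesgue_measure R]_(x in `[0%R, b]) (G (F x) * f x)%:E)%E.
Proof.
move=> b0 dF cf cG incF; have F' := is_derive_derive1 dF.
have cF : continuous F.
  move=> x; apply/differentiable_continuous; rewrite -derivable1_diffP.
  exact: ex_derive.
rewrite (@integration_by_substitution_increasing R F G 0 b)//.
- by rewrite F'.
- move=> x y; rewrite !in_itv/= => /andP[x0 _] /andP[y0 _].
  by apply: incF; rewrite in_itv/= andbT.
- by rewrite F' => x _; exact: cf.
- by rewrite F'; apply: (cvgP (f 0)); apply: cvg_at_right_filter; exact: cf.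
- by rewrite F'; apply: (cvgP (f b)); apply: cvg_at_left_filter; exact: cf.
- split.
  + by move=> x _; exact: ex_derive.
  + by apply: cvg_at_right_filter; exact: cF.
  + by apply: cvg_at_left_filter; exact: cF.
- exact: continuous_subspaceT.
Qed.

(** Passing to the limit in the substitution on [[0, n]] avoids any condition
    on the derivative at infinity, as the change of variable [z ^+ 2 / 2], whose
    derivative is unbounded, requires. *)
Lemma ge0_substitution_0y (R : realType) (F f G : R -> R) :
  (forall x, is_derive x (1 : R) F (f x)) -> continuous f -> continuous G ->
  (forall x, 0 <= x -> 0 <= f x) ->
  (forall x, 0 <= x -> 0 <= G x) ->
  {in `[0, +oo[ &, {homo F : x y / x < y}} -> F 0 = 0 ->
  (forall A, exists n : nat, A <= F n%:R) ->
  (\int[@lebesgue_measure R]_(x in `[0%R, +oo[) (G x)%:E =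
   \int[@lebesgue_measure R]_(x in `[0%R, +oo[) (G (F x) * f x)%:E)%E.
Proof.
move=> dF cf cG f0 G0 incF F0 Fy.
have mG : measurable_fun setT G by exact: continuous_measurable_fun.
have mf : measurable_fun setT f by exact: continuous_measurable_fun.
have mF : measurable_fun setT F.
  apply: continuous_measurable_fun => x.
  apply/differentiable_continuous; rewrite -derivable1_diffP.
  exact: ex_derive.
have mGF : measurable_fun setT (fun x => G (F x) * f x).
  by apply: measurable_funM => //; exact: (measurableT_comp mG mF).
have leF x y : 0 <= x -> x <= y -> F x <= F y.
  move=> x0; rewrite le_eqVlt => /predU1P[->//|xy].
  by apply/ltW/incF => //; rewrite in_itv/= andbT// (le_trans x0)// ltW.
have U1 : \bigcup_n `[0, F n%:R]%classic = `[0, +oo[%classic.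
  apply/seteqP; split => [x [n _]|x]/=; rewrite !in_itv/=.
    by move=> /andP[->].
  rewrite andbT => x0; have [n xn] := Fy x; exists n => //=.
  by rewrite in_itv/= x0.
have U2 : \bigcup_n `[0, n%:R]%classic = `[0, +oo[%classic :> set R.
  apply/seteqP; split => [x [n _]|x]/=; rewrite !in_itv/=.
    by move=> /andP[->].
  rewrite andbT => x0; exists (Num.bound x) => //=.
  by rewrite in_itv/= x0/= ltW// archi_boundP.
set mu := @lebesgue_measure R.
have cl : (\int[mu]_(x in `[0%R, F n%:R]) (G x)%:E)%E @[n --> \oo] -->
    (\int[mu]_(x in `[0%R, +oo[) (G x)%:E)%E.
  rewrite -U1; apply: ge0_nondecreasing_set_cvg_integral => //.
  - move=> m n mn; apply/subsetPset; apply: subset_itvl; rewrite bnd_simp.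
    by apply: leF; rewrite ?ler_nat.
  - by move=> i; apply/measurable_EFinP; exact: measurable_funTS.
  - by move=> i x /=; rewrite in_itv/= => /andP[x0 _]; rewrite lee_fin G0.
have cr : (\int[mu]_(x in `[0%R, n%:R]) (G (F x) * f x)%:E)%E @[n --> \oo] -->
    (\int[mu]_(x in `[0%R, +oo[) (G (F x) * f x)%:E)%E.
  rewrite -U2; apply: ge0_nondecreasing_set_cvg_integral => //.
  - move=> m n mn; apply/subsetPset; apply: subset_itvl; rewrite bnd_simp.
    by rewrite ler_nat.
  - by move=> i; apply/measurable_EFinP; exact: measurable_funTS.
  - move=> i x /=; rewrite in_itv/= => /andP[x0 _].
    by rewrite lee_fin mulr_ge0 ?f0// G0// -F0 leF.
rewrite -(cvg_lim _ cl)// -(cvg_lim _ cr)//; congr (lim (_ @ \oo)).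
apply/funext => n.
by have := @substitution_0b R F f G n%:R (ler0n _ _) dF cf cG incF; rewrite F0.
Qed.

Lemma Rintegral_0t_scale (R : realType) (G : R -> R) (t : R) :
  0 < t -> continuous G ->
  \int[@lebesgue_measure R]_(s in `[0, t]) G s =
  t * \int[@lebesgue_measure R]_(s in `[0, 1]) G (t * s).
Proof.
move=> t0 cG.
have cGt : continuous (fun s => G (t * s)).
  by move=> s; apply: continuous_comp; [exact: mulrl_continuous|exact: cG].
rewrite -RintegralZl//; last first.
  apply: continuous_compact_integrable; first exact: segment_compact.
  exact: continuous_subspaceT.
rewrite /Rintegral; congr fine.
have dF x : is_derive x (1 : R) (fun s : R => t * s) t.
  by apply: is_derive_eq; rewrite /GRing.scale/= mulr1.
have := @substitution_0b R _ _ G 1 ler01 dF.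
rewrite mulr0 mulr1 => ->//.
- by apply: eq_integral => s _; rewrite mulrC.
- by move=> x; exact: cvg_cst.
- by move=> x y _ _; rewrite ltr_pM2l.
Qed.

Lemma Rintegral_even_split (R : realType) (G : R -> R) (s t : R) :
  0 < s -> 0 < t -> continuous G -> (forall x, G (- x) = G x) ->
  \int[@lebesgue_measure R]_(x in `[- s, t]) G x =
  \int[@lebesgue_measure R]_(x in `[0, s]) G x +
  \int[@lebesgue_measure R]_(x in `[0, t]) G x.
Proof.
move=> s0 t0 cG evG.
have iG a b : (@lebesgue_measure R).-integrable `[a, b] (EFin \o G).
  apply: continuous_compact_integrable; first exact: segment_compact.
  exact: continuous_subspaceT.
apply/eqP; rewrite addrC -subr_eq; apply/eqP.
have -> : \int[@lebesgue_measure R]_(x in `[0, s]) G x =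
    \int[@lebesgue_measure R]_(x in `[- s, 0]) G x.
  rewrite /Rintegral; congr fine.
  have := @integration_by_substitution_oppr R G 0 s (ltW s0).
  rewrite oppr0 => ->; last exact: continuous_subspaceT.
  by apply: eq_integral => x _ /=; rewrite evG.
rewrite Rintegral_itvB//; last 2 first.
- by rewrite bnd_simp lerNl oppr0 ltW.
- by rewrite bnd_simp ltW.
rewrite Rintegral_itv_obnd_cbnd//.
by apply: integrableS (iG 0 t) => //; exact: subset_itv_oc_cc.
Qed.

(** * Moments of the Gaussian and the Gamma function *)

(** Up to normalization, the [n]-th moment of the half-normal law; it is the
    value of the Gamma function at [(n + 1) / 2] up to a power of [sqrt 2], see
    [Gamma_gauss_moment]. *)
Definition gauss_moment (R : realType) (n : nat) : \bar R :=
  (\int[@lebesgue_measure R]_(z in `[0%R, +oo[)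
    (z ^+ n * expR (- z ^+ 2 / 2))%:E)%E.

(** Comparing with the integrable function [(1 + z ^+ 2)^-1] is the only
    integrability criterion used on the half-line. *)
Lemma exprn_expR_le (R : realType) (n : nat) :
  exists2 C : R, 0 <= C &
    forall z, 0 <= z -> z ^+ n * expR (- z ^+ 2 / 2) <= C * (oneDsqr z)^-1.
Proof.
(* For k <= 2 (n + 2), z ^+ k <= 1 + z ^+ (2 (n + 2)), and the last power is at
   most B * expR (z ^+ 2 / 2) by one term of the exponential series. *)
pose B : R := 2 ^+ n.+2 * n.+2`!%:R.
have B0 : 0 <= B by rewrite mulr_ge0// exprn_ge0.
exists (2 * (1 + B)); first by rewrite mulr_ge0// addr_ge0.
move=> z z0; rewrite ler_pdivlMr ?oneDsqr_gt0// mulNr expRN.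
rewrite mulrAC ler_pdivrMr ?expR_gt0//.
have z1 k : (k <= (n.+2).*2)%N -> z ^+ k <= 1 + z ^+ (n.+2).*2.
  move=> kn; have [zle1|zge1] := leP z 1.
    by rewrite (le_trans (exprn_ile1 _ z0 zle1))// lerDl exprn_ge0.
  by rewrite (le_trans (ler_weXn2l (ltW zge1) kn))// lerDr.
have zB : z ^+ (n.+2).*2 <= B * expR (z ^+ 2 / 2).
  have -> : z ^+ (n.+2).*2 = B * ((z ^+ 2 / 2) ^+ n.+2 / n.+2`!%:R).
    rewrite exprMn exprVn -exprM mul2n /B; field.
    by rewrite expf_neq0//= pnatr_eq0 -lt0n fact_gt0.
  rewrite ler_wpM2l// (le_trans _ (@expR_ge1Dxn R (z ^+ 2 / 2) n.+1 _))//.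
    by rewrite lerDr.
  by rewrite divr_ge0// sqr_ge0.
apply: (@le_trans _ _ (2 * (1 + z ^+ (n.+2).*2))).
  rewrite /oneDsqr mulrDr mulr1 -exprD addn2 mulr2n mulrDl mul1r.
  have n2 : (n.+2 <= (n.+2).*2)%N by rewrite -addnn leq_addr.
  by rewrite lerD// z1// (leq_trans _ n2)// -addn2 leq_addr.
rewrite -mulrA ler_pM2l// mulrDl mul1r lerD//.
by rewrite -expR0 ler_expR divr_ge0// sqr_ge0.
Qed.

Lemma integral_oneDsqr_lty (R : realType) (C : R) (f : R -> R) :
  measurable_fun setT f -> (forall z, 0 <= z -> 0 <= f z <= C * (oneDsqr z)^-1) ->
  (\int[@lebesgue_measure R]_(z in `[0%R, +oo[) (f z)%:E < +oo)%E.
Proof.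
move=> mf fC.
have C0 : 0 <= C.
  have /andP[f0] := fC 0 (lexx _); rewrite /oneDsqr expr0n addr0 invr1 mulr1.
  exact: le_trans.
have moD : measurable_fun setT (fun z : R => (oneDsqr z)^-1).
  by apply: continuous_measurable_fun; exact: continuous_oneDsqrV.
apply: (@le_lt_trans _ _ (\int[@lebesgue_measure R]_(z in `[0%R, +oo[)
    (C * (oneDsqr z)^-1)%:E)%E).
  apply: ge0_le_integral => //.
  - by move=> z/=; rewrite in_itv/= andbT lee_fin => /fC/andP[].
  - by apply/measurable_EFinP; exact: measurable_funTS.
  - apply/measurable_EFinP; apply: measurable_funTS.
    exact: measurable_funM.
  - by move=> z/=; rewrite in_itv/= andbT lee_fin => /fC/andP[].
under eq_integral do rewrite EFinM.
rewrite ge0_integralZl//.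
- by rewrite integral0y_oneDsqr -EFinM ltry.
- by apply/measurable_EFinP; exact: measurable_funTS.
Qed.

Lemma continuous_moment (R : realType) n :
  continuous (fun z : R => `|z| ^+ n * expR (- z ^+ 2 / 2)).
Proof.
move=> z; apply: (@cvgM R R _ _ (fun z : R => `|z| ^+ n)).
  apply: (@continuous_comp _ _ _ (fun z : R => `|z|) (fun x => x ^+ n)).
    exact: norm_continuous.
  exact: exprn_continuous.
apply: (@continuous_comp _ _ _ (fun z : R => - z ^+ 2 / 2) expR).
  by apply: cvgMr_tmp; apply: cvgN; exact: exprn_continuous.
exact: continuous_expR.
Qed.

(** With the absolute value the integrand is nonnegative and continuous on the
    whole line, as the substitution lemmas require, whatever the parity of
    [n]. *)
Lemma gauss_moment_norm (R : realType) n : gauss_moment R n =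
  (\int[@lebesgue_measure R]_(z in `[0%R, +oo[)
    (`|z| ^+ n * expR (- z ^+ 2 / 2))%:E)%E.
Proof.
apply: eq_integral => z; rewrite inE/= in_itv/= andbT => z0.
by rewrite ger0_norm.
Qed.

Lemma gauss_moment_fin_num (R : realType) n : gauss_moment R n \is a fin_num.
Proof.
have [C C0 HC] := exprn_expR_le R n.
rewrite ge0_fin_numE; last first.
  apply: integral_ge0 => z/=; rewrite in_itv/= andbT lee_fin => z0.
  by rewrite mulr_ge0 ?exprn_ge0 ?expR_ge0.
rewrite gauss_moment_norm; apply: (@integral_oneDsqr_lty _ C).
  by apply: continuous_measurable_fun; exact: continuous_moment.
move=> z z0; rewrite mulr_ge0 ?exprn_ge0 ?expR_ge0//=.
by rewrite ger0_norm// HC.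
Qed.

Lemma gauss_moment_gt0 (R : realType) n : (0 < gauss_moment R n)%E.
Proof.
(* On [1, 2] the integrand is at least expR (- 2). *)
apply: (@lt_le_trans _ _ (\int[@lebesgue_measure R]_(z in `[1%R, 2%R])
    (expR (- 2))%:E)%E).
  rewrite integral_cst//= lebesgue_measure_itv/= lte_fin ltr1n/= -EFinB -EFinM.
  by rewrite lte_fin mulr_gt0 ?expR_gt0// subr_gt0 ltr1n.
rewrite gauss_moment_norm.
have mm (D : set R) :
    measurable_fun D (fun z : R => (`|z| ^+ n * expR (- z ^+ 2 / 2))%:E).
  apply/measurable_EFinP; apply: measurable_funTS.
  by apply: continuous_measurable_fun; exact: continuous_moment.
apply: (@le_trans _ _ (\int[@lebesgue_measure R]_(z in `[1%R, 2%R])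
  (`|z| ^+ n * expR (- z ^+ 2 / 2))%:E)%E).
  apply: ge0_le_integral => //.
  - exact: mm.
  - move=> z/=; rewrite in_itv/= => /andP[z1 z2].
    have z0 : 0 <= z by rewrite (le_trans _ z1).
    rewrite lee_fin ger0_norm// -[leLHS]mul1r ler_pM ?expR_ge0 ?exprn_ege1//.
    by rewrite ler_expR; nra.
apply: ge0_subset_integral => //.
- exact: mm.
- by move=> z/=; rewrite !in_itv/= andbT => /andP[z1 _]; rewrite (le_trans _ z1).
Qed.

(** This is the Laplace-type representation of the volume density: for
    [a = 1 + kappa * |y|^2] the right-hand side is [a] to the power
    [- (n + 1) / 2], up to a constant independent of [a]. *)
Lemma gauss_moment_scale (R : realType) n (a : R) : 0 < a ->
  (\int[@lebesgue_measure R]_(z in `[0%R, +oo[)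
    (z ^+ n * expR (- (z ^+ 2 * a) / 2))%:E =
   ((Num.sqrt a ^+ n.+1)^-1)%:E * gauss_moment R n)%E.
Proof.
move=> a0; have sa0 : 0 < Num.sqrt a by rewrite sqrtr_gt0.
rewrite gauss_moment_norm.
have dF x : is_derive x (1 : R) (fun z => Num.sqrt a * z) (cst (Num.sqrt a) x).
  by apply: is_derive_eq; rewrite /GRing.scale/= mulr1.
rewrite [X in (_ * X)%E](@ge0_substitution_0y R _ (cst (Num.sqrt a)) _ dF)//.
- rewrite -ge0_integralZl//.
  + apply: eq_integral => z; rewrite inE/= in_itv/= andbT => z0.
    rewrite -EFinM; congr EFin.
    rewrite normrM !ger0_norm ?sqrtr_ge0// !exprMn sqr_sqrtr ?ltW//.
    rewrite (mulrC a) [_ a ^+ n.+1]exprS; field.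
    by rewrite !expf_neq0 gt_eqF.
  + apply/measurable_EFinP; apply: measurable_funTS.
    apply: measurable_funM => //.
    apply: continuous_measurable_fun => z.
    apply: (@continuous_comp _ _ _ (fun z => Num.sqrt a * z)
      (fun z => `|z| ^+ n * expR (- z ^+ 2 / 2))).
      exact: mulrl_continuous.
    exact: continuous_moment.
  + move=> z _.
    by rewrite lee_fin mulr_ge0 ?sqrtr_ge0// mulr_ge0 ?exprn_ge0 ?expR_ge0.
- by move=> x; exact: cvg_cst.
- exact: continuous_moment.
- by move=> x _ /=; rewrite sqrtr_ge0.
- by move=> x y _ _; rewrite ltr_pM2l.
- by rewrite mulr0.
- move=> A; exists (Num.bound `|A / Num.sqrt a|).
  by rewrite -ler_pdivrMl// mulrC ltW// (le_lt_trans (ler_norm _))// archi_boundP.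
Qed.

(** The substitution [t = z ^+ 2 / 2]. *)
Lemma Gamma_gauss_moment (R : realType) n :
  (\int[@lebesgue_measure R]_(t in `]0%R, +oo[)
    (t `^ (n.+2%:R / 2 - 1) * expR (- t))%:E =
   ((Num.sqrt 2 ^+ n)^-1)%:E * gauss_moment R n.+1)%E.
Proof.
(* On positive reals this is the Gamma integrand; written with a square root
   it is continuous on the whole line. *)
pose G (t : R) := Num.sqrt t ^+ n * expR (- t).
have cG : continuous G.
  move=> z; apply: (@cvgM R R _ _ (fun z : R => Num.sqrt z ^+ n)).
    apply: (@continuous_comp _ _ _ (@Num.sqrt R) (fun x => x ^+ n)).
      exact: sqrt_continuous.
    exact: exprn_continuous.
  apply: (@continuous_comp _ _ _ (fun z : R => - z) expR).
    exact: oppr_continuous.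
  exact: continuous_expR.
have mG : measurable_fun setT G by exact: continuous_measurable_fun.
transitivity (\int[@lebesgue_measure R]_(t in `]0%R, +oo[) (G t)%:E)%E.
  apply: eq_integral => t; rewrite inE/= in_itv/= andbT => t0.
  congr (_ * _)%:E; rewrite -powR12_sqrt ?ltW// -powR_mulrn ?powR_ge0//.
  rewrite -powRrM; congr (_ `^ _).
  by rewrite -(addn2 n) natrD; field.
rewrite integral_itv_obnd_cbnd; last first.
  by apply/measurable_EFinP; exact: measurable_funTS.
have dF x : is_derive x (1 : R) (fun z => z ^+ 2 / 2) (id x).
  by apply: is_derive_eq; rewrite /GRing.scale/=; field.
rewrite (@ge0_substitution_0y R _ id _ dF)//.
- rewrite -ge0_integralZl//.
  + apply: eq_integral => z; rewrite inE/= in_itv/= andbT => z0.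
    rewrite -EFinM; congr EFin; rewrite /G sqrtrM ?sqr_ge0// sqrtr_sqr.
    rewrite ger0_norm// exprMn sqrtrV// exprVn [z ^+ n.+1]exprS mulNr.
    ring.
  + apply/measurable_EFinP; apply: measurable_funTS.
    apply: measurable_funM; first exact: exprn_measurable.
    apply: measurableT_comp; first exact: measurable_expR.
    apply: measurable_funM => //.
    by apply: measurableT_comp => //; exact: exprn_measurable.
  + move=> z/=; rewrite in_itv/= andbT => z0.
    by rewrite lee_fin mulr_ge0 ?expR_ge0// exprn_ge0.
- by move=> x; exact: cvg_id.
- by move=> x _; rewrite mulr_ge0 ?exprn_ge0 ?sqrtr_ge0 ?expR_ge0.
- move=> x y; rewrite !in_itv/= !andbT => x0 y0 xy.
  by rewrite ltr_pM2r ?invr_gt0// ltrXn2r// ?nnegrE.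
- by rewrite expr0n mul0r.
- move=> A; exists (Num.bound `|A|).+2.
  have := archi_boundP (normr_ge0 A); have := ler_norm A.
  rewrite -addn2 natrD; set m : R := (Num.bound _)%:R => Am mA.
  have m0 : 0 <= m by exact: ler0n.
  nra.
Qed.

(** * Gaussian integrals over a segment *)

Definition gauss_slab (R : realType) (c a b : R) : R :=
  \int[@lebesgue_measure R]_(s in `[- a, b]) expR (c * s ^+ 2).

Lemma continuous_gauss (R : realType) (c : R) :
  continuous (fun s : R => expR (c * s ^+ 2)).
Proof.
move=> s; apply: (@continuous_comp _ _ _ (fun s : R => c * s ^+ 2) expR).
  apply: (@continuous_comp _ _ _ (fun s : R => s ^+ 2) (fun x => c * x)).
    exact: exprn_continuous.
  exact: mulrl_continuous.
exact: continuous_expR.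
Qed.

Lemma integrable_gauss (R : realType) (c a b : R) :
  (@lebesgue_measure R).-integrable `[a, b]
    (EFin \o (fun s : R => expR (c * s ^+ 2))).
Proof.
apply: continuous_compact_integrable; first exact: segment_compact.
by apply: continuous_subspaceT; exact: continuous_gauss.
Qed.

Lemma gauss_slab_ge0 (R : realType) (c a b : R) : 0 <= gauss_slab c a b.
Proof. by apply: Rintegral_ge0 => s _; exact: expR_ge0. Qed.

Lemma gauss_slabE (R : realType) (c a b : R) :
  (gauss_slab c a b)%:E =
  (\int[@lebesgue_measure R]_(s in `[(- a)%R, b]) (expR (c * s ^+ 2))%:E)%E.
Proof.
rewrite /gauss_slab /Rintegral fineK//.
by apply: integrable_fin_num => //; exact: integrable_gauss.
Qed.

Lemma gauss_slab_split (R : realType) (c a b : R) : 0 < a -> 0 < b ->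
  gauss_slab c a b =
  \int[@lebesgue_measure R]_(s in `[0, a]) expR (c * s ^+ 2) +
  \int[@lebesgue_measure R]_(s in `[0, b]) expR (c * s ^+ 2).
Proof.
move=> a0 b0; apply: Rintegral_even_split => //; first exact: continuous_gauss.
by move=> x; rewrite sqrrN.
Qed.

(** The right-hand side is the shape in which the integral over a segment occurs
    in [Phi]. *)
Lemma gauss_slab_scale (R : realType) (c a b : R) : 0 < a -> 0 < b ->
  gauss_slab c a b =
  a * \int[@lebesgue_measure R]_(s in `[0, 1]) expR (c * (a * s) ^+ 2) +
  b * \int[@lebesgue_measure R]_(s in `[0, 1]) expR (c * (b * s) ^+ 2).
Proof.
move=> a0 b0; rewrite gauss_slab_split//.
by rewrite !(@Rintegral_0t_scale _ (fun s => expR (c * s ^+ 2)))//;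
  exact: continuous_gauss.
Qed.

Lemma Rintegral_0t_le (R : realType) (G : R -> R) (t M : R) : 0 < t ->
  continuous G -> (forall s, 0 <= s <= t -> G s <= M) ->
  \int[@lebesgue_measure R]_(s in `[0, t]) G s <= t * M.
Proof.
move=> t0 cG GM.
have -> : t * M = \int[@lebesgue_measure R]_(s in `[0, t]) (cst M) s.
  rewrite Rintegral_cst//= lebesgue_measure_itv/= lte_fin t0 -EFinB/= subr0.
  by rewrite mulrC.
apply: le_Rintegral => //.
- apply: continuous_compact_integrable; first exact: segment_compact.
  exact: continuous_subspaceT.
- apply: continuous_compact_integrable; first exact: segment_compact.
  by apply: continuous_subspaceT => x; exact: cvg_cst.
Qed.

Lemma gauss_slab_le (R : realType) (c a b : R) : c <= 0 -> 0 < a -> 0 < b ->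
  gauss_slab c a b <= a + b.
Proof.
move=> c0 a0 b0; rewrite gauss_slab_split//.
by apply: lerD; rewrite -[leRHS]mulr1; apply: Rintegral_0t_le => //;
  [exact: continuous_gauss|move=> s _; rewrite expR_le1 mulr_le0_ge0 ?sqr_ge0//
  |exact: continuous_gauss|move=> s _; rewrite expR_le1 mulr_le0_ge0 ?sqr_ge0//].
Qed.

(** A bound of Dawson type: on [[0, t]] one has [s ^+ 2 <= t * s], and
    [expR (c * t * s)] has an explicit primitive. *)
Lemma Rintegral_expR_sqr_le (R : realType) (c t : R) : 0 <= c -> 0 < t ->
  c * \int[@lebesgue_measure R]_(s in `[0, t]) expR (c * s ^+ 2) <=
  t^-1 * expR (c * t ^+ 2).
Proof.
move=> c0 t0.
have cl : continuous (fun s : R => c * expR (c * t * s)).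
  move=> s; apply: (@continuous_comp _ _ _ (fun s : R => expR (c * t * s))
    (fun x => c * x)); last exact: mulrl_continuous.
  apply: (@continuous_comp _ _ _ (fun s : R => c * t * s) expR).
    exact: mulrl_continuous.
  exact: continuous_expR.
rewrite -RintegralZl//; last exact: integrable_gauss.
apply: (@le_trans _ _
    (\int[@lebesgue_measure R]_(s in `[0, t]) (c * expR (c * t * s)))).
  apply: le_Rintegral => //.
  - apply: continuous_compact_integrable; first exact: segment_compact.
    apply: continuous_subspaceT => s.
    apply: (@continuous_comp _ _ _ (fun s : R => expR (c * s ^+ 2))
      (fun x => c * x)); last exact: mulrl_continuous.
    exact: continuous_gauss.
  - apply: continuous_compact_integrable; first exact: segment_compact.
    exact: continuous_subspaceT.
  - move=> s /=; rewrite in_itv/= => /andP[s0 st].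
    rewrite ler_wpM2l// ler_expR -mulrA ler_wpM2l// expr2.
    by rewrite ler_wpM2r.
have dF (x : R) : is_derive x (1 : R) (fun s => t^-1 * expR (c * t * s))
    (c * expR (c * t * x)).
  apply: is_derive_eq; rewrite /GRing.scale/=; field.
  by rewrite gt_eqF.
have cF : continuous (fun s => t^-1 * expR (c * t * s)).
  move=> x; apply/differentiable_continuous; rewrite -derivable1_diffP.
  exact: ex_derive.
rewrite /Rintegral (@continuous_FTC2 _ _ (fun s => t^-1 * expR (c * t * s)))//.
- by rewrite -EFinB/= mulr0 expR0 -mulrA -expr2 gerBl mulr1 invr_ge0 ltW.
- exact: continuous_subspaceT.
- split.
  + by move=> x _; exact: ex_derive.
  + by apply: cvg_at_right_filter; exact: cF.
  + by apply: cvg_at_left_filter; exact: cF.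
- by move=> x _; rewrite derive1E derive_val.
Qed.

(** The factor [z / oneDsqr z] carries the decay at infinity that makes the
    radial integral converge when a vertex of the box lies on the boundary of the
    ball: the exponentials on the right-hand sides, multiplied over the
    coordinates, then exactly compensate [expR (- z ^+ 2 / 2)]. *)
Lemma gauss_slab_decay (R : realType) (k a b m z : R) : 0 < k ->
  0 < a <= m -> 0 < b <= m -> 0 <= z ->
  z * gauss_slab (k * z ^+ 2 / 2) a b <=
  (a + b + 2 / k * (a^-1 + b^-1)) * expR (k * z ^+ 2 / 2 * m ^+ 2) *
  (z / oneDsqr z).
Proof.
move=> k0 /andP[a0 am] /andP[b0 bm] z0.
rewrite [leRHS]mulrCA; apply: ler_wpM2l => //.
set c := k * z ^+ 2 / 2.
have c0 : 0 <= c by rewrite divr_ge0// mulr_ge0 ?sqr_ge0// ltW.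
have Em t : 0 < t -> t <= m -> expR (c * t ^+ 2) <= expR (c * m ^+ 2).
  move=> t0 tm; rewrite ler_expR ler_wpM2l// lerXn2r// nnegrE.
    exact: ltW.
  exact: le_trans (ltW t0) tm.
have H1 t : 0 < t -> t <= m ->
    \int[@lebesgue_measure R]_(s in `[0, t]) expR (c * s ^+ 2) <=
    t * expR (c * m ^+ 2).
  move=> t0 tm; apply: Rintegral_0t_le => //; first exact: continuous_gauss.
  move=> s /andP[s0 st]; apply: le_trans (Em _ t0 tm).
  by rewrite ler_expR ler_wpM2l// lerXn2r// nnegrE ltW.
have H2 t : 0 < t -> t <= m ->
    c * \int[@lebesgue_measure R]_(s in `[0, t]) expR (c * s ^+ 2) <=
    t^-1 * expR (c * m ^+ 2).
  move=> t0 tm; apply: (le_trans (Rintegral_expR_sqr_le c0 t0)).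
  by rewrite ler_wpM2l ?invr_ge0 ?(ltW t0)// Em.
(* The bound by the length of the segment controls the term 1 of 1 + z ^+ 2,
   the Dawson bound the term z ^+ 2 = 2 / k * c. *)
rewrite ler_pdivlMr ?oneDsqr_gt0// gauss_slab_split// /oneDsqr.
set A := (X in X + _); set B := (X in _ + X).
have -> : (A + B) * (1 + z ^+ 2) = A + B + 2 / k * (c * A + c * B).
  by rewrite /c; field; rewrite gt_eqF.
rewrite [leRHS]mulrDl lerD//.
  by rewrite mulrDl lerD// H1.
rewrite -[leRHS]mulrA ler_wpM2l//; first by rewrite divr_ge0// ltW.
by rewrite mulrDl lerD// H2.
Qed.

(** * The function Phi on the real and imaginary axes *)

Lemma csqrt_sqr (R : realType) (a : R) : csqrt a ^+ 2 = a%:C.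
Proof.
rewrite /csqrt; case: leP => [a0|a0].
  by rewrite -rmorphXn/= sqr_sqrtr.
rewrite expr2; simpc; rewrite -expr2 sqr_sqrtr ?oppr_ge0 ?ltW//.
by rewrite opprK.
Qed.

Lemma csqrt_neq0 (R : realType) (a : R) : a != 0 -> csqrt a != 0.
Proof.
move=> a0; apply/negP => /eqP c0; have := csqrt_sqr a.
by rewrite c0 expr0n/= => /(congr1 (@complex.Re R))/= /esym/eqP; exact/negP.
Qed.

Lemma cexp_real (R : realType) (x : R) : cexp x%:C = (expR x)%:C.
Proof. by rewrite /cexp/= cos0 sin0 mulr1. Qed.

Lemma cintegral_real (R : realType) (D : set R) (f : R -> R) :
  cintegral D (fun t => (f t)%:C) = (\int[@lebesgue_measure R]_(t in D) f t)%:C.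
Proof.
rewrite /cintegral/=; congr (_ +i* _).
by rewrite /Rintegral integral0.
Qed.

(** The square of [csqrt k] is real, so that along both the real and the imaginary
    axis the integrand of [Phi] is a real Gaussian. *)
Lemma Phi_scaled_csqrt (R : realType) (k t z : R) :
  Phi (t%:C * csqrt k * z%:C) =
  2^-1 + csqrt k * ((Num.sqrt (2 * pi))^-1 * (z * (t *
    \int[@lebesgue_measure R]_(s in `[0, 1])
      expR (- (k * z ^+ 2) / 2 * (t * s) ^+ 2))))%:C.
Proof.
rewrite /Phi; congr (_ + _).
rewrite (_ : cintegral _ _ = (\int[@lebesgue_measure R]_(s in `[0, 1])
    expR (- (k * z ^+ 2) / 2 * (t * s) ^+ 2))%:C).
  by rewrite !rmorphM/=; ring.
rewrite -cintegral_real; congr cintegral.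
apply/funext => s; rewrite -cexp_real; congr cexp.
rewrite !exprMn csqrt_sqr -!rmorphXn/=.
have -> : (2 : R[i]) = (2 : R)%:C by rewrite rmorphMn.
rewrite -!rmorphM/= -rmorphN/= -fmorphV/= -rmorphM/=.
by congr (_%:C); field.
Qed.

(** One identity covers both signs of the curvature: all that is not real is the
    factor [csqrt k]. *)
Lemma Phi_diff_gauss_slab (R : realType) (k a b z : R) : 0 < a -> 0 < b ->
  Phi (b%:C * csqrt k * z%:C) - Phi (- a%:C * csqrt k * z%:C) =
  csqrt k * ((Num.sqrt (2 * pi))^-1 *
             (z * gauss_slab (- (k * z ^+ 2) / 2) a b))%:C.
Proof.
move=> a0 b0; rewrite gauss_slab_scale//.
rewrite (_ : - a%:C = (- a)%:C); last by rewrite rmorphN.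
rewrite !Phi_scaled_csqrt.
under [X in - a * X]eq_Rintegral do rewrite [- a * _]mulNr sqrrN.
set I := \int[_]_(s in _) _; set J := \int[_]_(s in _) _.
ring.
Qed.

(** * The ball model and the box *)

Definition sqnorm (R : realType) n (y : 'rV[R]_n) : R := \sum_i y ord0 i ^+ 2.

Lemma sqnorm_ge0 (R : realType) n (y : 'rV[R]_n) : 0 <= sqnorm y.
Proof. by apply: sumr_ge0 => i _; exact: sqr_ge0. Qed.

Lemma enorm_sqr (R : realType) n (y : 'rV[R]_n) : enorm y ^+ 2 = sqnorm y.
Proof. by rewrite /enorm sqr_sqrtr// sqnorm_ge0. Qed.

Lemma measurable_sqnorm (R : realType) n :
  measurable_fun setT (@sqnorm R n).
Proof.
by apply: measurable_sum => i; apply: measurable_funX; exact: measurable_rV_coord.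
Qed.

Lemma continuous_sqnorm (R : realType) n : continuous (@sqnorm R n).
Proof.
rewrite (_ : @sqnorm R n = fun y => \sum_i y ord0 i ^+ 2)//.
apply: continuous_big => [|i _ y]; first exact: add_continuous.
apply: (@continuous_comp _ _ _ (fun y : 'rV[R]_n => y ord0 i) (fun x => x ^+ 2)).
  exact: coord_continuous.
exact: exprn_continuous.
Qed.

(** The ball model is where the quantity raised to a power in the volume density
    is positive, whatever the sign of the curvature. *)
Lemma kleinE (R : realType) n (k : R) :
  klein k = [set y : 'rV[R]_n | 0 < 1 + k * sqnorm y].
Proof.
rewrite /klein; case: leP => [k0|k0].
  apply/esym/seteqP; split => // y _ /=.
  by rewrite ltr_pwDl// mulr_ge0// sqnorm_ge0.
have k0' : 0 < Num.sqrt (- k) by rewrite sqrtr_gt0 oppr_gt0.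
apply/funext => y /=; congr is_true.
rewrite -[X in _ < X]mul1r ltr_pdivlMr// -sqrtrM ?sqnorm_ge0//.
rewrite -[X in _ < X]sqrtr1 ltr_sqrt// mulrN mulrC -subr_gt0 opprK.
by rewrite /sqnorm.
Qed.

Lemma measurable_klein (R : realType) n (k : R) :
  measurable (klein k : set 'rV[R]_n).
Proof.
rewrite kleinE (_ : [set _ | _] = (fun y => 1 + k * sqnorm y) @^-1` `]0, +oo[).
  rewrite -[X in measurable X]setTI.
  have : measurable_fun setT (fun y : 'rV[R]_n => 1 + k * sqnorm y).
    apply: measurable_funD => //; apply: measurable_funM => //.
    exact: measurable_sqnorm.
  by apply.
by apply/seteqP; split => y /=; rewrite in_itv/= andbT.
Qed.

Lemma klein_closure_le (R : realType) n (k : R) (y : 'rV[R]_n) :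
  klein_closure k y -> 0 <= 1 + k * sqnorm y.
Proof.
rewrite /klein_closure closureE => /(_ [set y | 0 <= 1 + k * sqnorm y]); apply.
split; last by rewrite kleinE => x /= /ltW.
apply: (@preimage_closed 'rV[R]_n R (fun y => 1 + k * sqnorm y) [set x | 0 <= x]);
  last exact: closed_ge.
move=> x _; apply: (@continuous_comp _ _ _ (@sqnorm R n) (fun x => 1 + k * x)).
  exact: continuous_sqnorm.
by apply: cvgD; [exact: cvg_cst|exact: mulrl_continuous].
Qed.

(** A point of the box on the boundary of the ball has each coordinate at an
    endpoint: otherwise moving that coordinate away from 0 would stay in the box
    and leave the closed ball. Looking at one coordinate suffices, since faces of
    the box are null. *)
Lemma box_minus_klein_null (R : realType) n (k : R) (a b : 'I_n -> R)
    (i : 'I_n) :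
  (forall j, 0 < a j) -> (forall j, 0 < b j) ->
  box (fun j => - a j) b `<=` klein_closure k ->
  lebesgue_rV n (box (fun j => - a j) b `\` klein k) = 0.
Proof.
move=> a0 b0 Pk; set P := box _ _.
pose upd (f : 'I_n -> R) x j := if j == i then x else f j.
pose A := box (upd (fun j => - a j) (b i)) b.
pose B := box (fun j => - a j) (upd b (- a i)).
have ab j : - a j <= b j by rewrite (@le_trans _ _ 0)// ?oppr_le0 ltW.
have A0 : lebesgue_rV n A = 0.
  rewrite lebesgue_rV_box; last by move=> j; rewrite /upd; case: eqP => [->|_].
  by rewrite (bigD1 i)//= /upd eqxx subrr mul0r.
have B0 : lebesgue_rV n B = 0.
  rewrite lebesgue_rV_box; last by move=> j; rewrite /upd; case: eqP => [->|_].
  by rewrite (bigD1 i)//= /upd eqxx subrr mul0r.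
apply: (@subset_measure0 _ _ _ (lebesgue_rV n) _ (A `|` B)).
- apply: measurableD; first exact: measurable_box.
  exact: measurable_klein.
- by apply: measurableU; exact: measurable_box.
- move=> y [Py]; rewrite kleinE/= => /negP; rewrite -leNgt => yk.
  have /andP[ayi yib] := Py i.
  have [yib'|yib'] := eqVneq (y ord0 i) (b i).
    left => j; rewrite /upd; case: eqP => [->|_]; last exact: Py.
    by rewrite yib' lexx.
  have [yia'|yia'] := eqVneq (y ord0 i) (- a i).
    right => j; rewrite /upd; case: eqP => [->|_]; last exact: Py.
    by rewrite yia' lexx.
  exfalso.
  (* y' is y with its i-th coordinate moved away from 0 to an endpoint. *)
  pose y' : 'rV[R]_n := \row_j
    upd (fun j => y ord0 j) (if 0 <= y ord0 i then b i else - a i) j.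
  have Py' : P y'.
    move=> j; rewrite mxE /upd; case: eqP => [->|_]; last exact: Py.
    by case: ifP; rewrite lexx ?ab.
  have := klein_closure_le (Pk _ Py').
  have k0 : k < 0.
    rewrite ltNge; apply/negP => k0; move: yk; apply/negP; rewrite -ltNge.
    by rewrite ltr_pwDl// mulr_ge0// sqnorm_ge0.
  have yy' : sqnorm y < sqnorm y'.
    rewrite /sqnorm (bigD1 i)//= [ltRHS](bigD1 i)//=.
    rewrite [X in _ + X < _](_ : _ = \sum_(j < n | j != i) y' ord0 j ^+ 2).
      rewrite ltrD2r mxE /upd eqxx.
      have := b0 i; have := a0 i.
      by case: ifP => [y0|/negbT]; last rewrite -ltNge; nra.
    by apply: eq_bigr => j ji; rewrite mxE /upd (negbTE ji).
  rewrite leNgt; apply/negP; rewrite negbK; apply: lt_le_trans yk.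
  by rewrite ltrD2l ltr_nM2l.
- by rewrite -A0; apply: measureU0 => //; exact: measurable_box.
Qed.

(** * Exchanging the radial integral and the integral over the box *)

Lemma measurable_integral_in d1 d2 (T1 : measurableType d1)
    (T2 : measurableType d2) (R : realType)
    (m1 : {sigma_finite_measure set T1 -> \bar R})
    (A : set T1) (f : T1 * T2 -> \bar R) :
  measurable A -> measurable_fun setT f -> (forall p, 0 <= f p)%E ->
  measurable_fun setT (fun y => \int[m1]_(x in A) f (x, y))%E.
Proof.
move=> mA mf f0.
rewrite (_ : (fun _ => _) = fubini_G m1 (f \_ (A `*` setT))).
  apply: measurable_fun_fubini_tonelli_G.
    apply/(measurable_restrictT _ _).1; first exact: measurableX.
    exact: measurable_funTS.
  by move=> p; rewrite patchE; case: ifP.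
apply/funext => y; rewrite integral_mkcond; apply: eq_integral => x _.
by rewrite !patchE in_setX/= in_setT andbT.
Qed.

Lemma measurable_klein_density (R : realType) d (k p : R) :
  measurable_fun setT (fun y : 'rV[R]_d => ((1 + k * enorm y ^+ 2) `^ p)^-1).
Proof.
under eq_fun do rewrite enorm_sqr -powRN.
apply: (@measurableT_comp _ _ _ _ _ _ (fun x => x `^ (- p))).
  exact: measurable_powR.
apply: measurable_funD => //; apply: measurable_funM => //.
exact: measurable_sqnorm.
Qed.

(** Up to the power of [csqrt k] and of [sqrt (2 * pi)], the integrand of the
    theorem. The absolute value makes it, like [laplace_kernel], nonnegative on the
    whole line, where Tonelli applies. *)
Definition slab_product (R : realType) d (k : R) (a b : 'I_d -> R) (z : R) : R :=
  (\prod_(j < d) (`|z| * gauss_slab (- (k * z ^+ 2) / 2) (a j) (b j))) *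
  expR (- z ^+ 2 / 2).

Definition laplace_kernel (R : realType) d (k : R) (p : R * 'rV[R]_d) : R :=
  `|p.1| ^+ d * expR (- (p.1 ^+ 2 * (1 + k * sqnorm p.2)) / 2).

Lemma slab_product_ge0 (R : realType) d (k : R) (a b : 'I_d -> R) (z : R) :
  0 <= slab_product k a b z.
Proof.
rewrite mulr_ge0 ?expR_ge0// prodr_ge0// => j _.
by rewrite mulr_ge0// gauss_slab_ge0.
Qed.

Lemma laplace_kernel_ge0 (R : realType) d (k : R) (p : R * 'rV[R]_d) :
  0 <= laplace_kernel k p.
Proof. by rewrite mulr_ge0 ?expR_ge0// exprn_ge0. Qed.

Lemma measurable_laplace_kernel (R : realType) d (k : R) :
  measurable_fun setT (@laplace_kernel R d k).
Proof.
apply: measurable_funM.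
  by apply: measurable_funX; apply: measurableT_comp.
apply: measurableT_comp; first exact: measurable_expR.
apply: measurable_funM => //; apply: measurableT_comp => //.
apply: measurable_funM; first exact: measurable_funX.
apply: measurable_funD => //; apply: measurable_funM => //.
by apply: measurableT_comp; [exact: measurable_sqnorm|].
Qed.

(** A Gaussian in [y] is a product over coordinates, hence so is its integral over
    a box. *)
Lemma integral_box_laplace_kernel (R : realType) d (k : R) (a b : 'I_d -> R)
    (z : R) :
  (\int[lebesgue_rV d]_(y in box (fun j => - a j)%R b)
     (laplace_kernel k (z, y))%:E =
   (slab_product k a b z)%:E)%E.
Proof.
set c := - (k * z ^+ 2) / 2.
transitivity (\int[lebesgue_rV d]_(y in box (fun j => - a j)%R b)
    ((`|z| ^+ d * expR (- z ^+ 2 / 2))%:E *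
     (\prod_(j < d) expR (c * y ord0 j ^+ 2))%:E))%E.
  apply: eq_integral => y _; rewrite -EFinM; congr EFin.
  rewrite /laplace_kernel/= -expR_sum -[RHS]mulrA -expRD; congr (_ * expR _).
  by rewrite -mulr_sumr /c /sqnorm; ring.
rewrite ge0_integralZl//; last 3 first.
- exact: measurable_box.
- apply: measurable_funTS; apply: measurable_fun_EFin.
  apply: measurable_fun_prodr => i.
  apply: (@measurableT_comp _ _ _ _ _ _ (fun s : R => expR (c * s ^+ 2))).
    by apply: continuous_measurable_fun; exact: continuous_gauss.
  exact: measurable_rV_coord.
- by move=> y _; rewrite lee_fin prodr_ge0// => j _; exact: expR_ge0.
rewrite (@integral_box_prod R d (fun j => - a j) b
  (fun _ s => expR (c * s ^+ 2))).
- under eq_bigr do rewrite -gauss_slabE.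
  rewrite prodEFin -EFinM; congr EFin.
  by rewrite /slab_product big_split/= prodr_const card_ord mulrAC.
- by move=> _; apply: continuous_measurable_fun; exact: continuous_gauss.
- by move=> _ s; exact: expR_ge0.
Qed.

Lemma measurable_slab_product (R : realType) d (k : R) (a b : 'I_d -> R) :
  measurable_fun setT (slab_product k a b).
Proof.
apply/measurable_EFinP.
rewrite (_ : _ \o _ = fubini_F (lebesgue_rV d)
   ((EFin \o @laplace_kernel R d k) \_ (setT `*` box (fun j => - a j) b))).
  apply: measurable_fun_fubini_tonelli_F.
    apply/(measurable_restrictT _ _).1.
      by apply: measurableX => //; exact: measurable_box.
    apply: measurable_funTS; apply: measurable_fun_EFin.
    exact: measurable_laplace_kernel.
  move=> p; rewrite patchE; case: ifP => // _.
  by rewrite lee_fin laplace_kernel_ge0.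
apply/funext => z /=; rewrite -integral_box_laplace_kernel integral_mkcond.
by apply: eq_integral => y _; rewrite /fubini_F !patchE in_setX/= in_setT.
Qed.

(** The case [a = 1 + k * |y|^2] of the scaling of Gaussian moments; the ball
    model is where this [a] is positive. *)
Lemma integral_laplace_kernel (R : realType) d (k : R) (y : 'rV[R]_d) :
  klein k y ->
  (\int[@lebesgue_measure R]_(z in `[0%R, +oo[) (laplace_kernel k (z, y))%:E =
   gauss_moment R d * (((1 + k * enorm y ^+ 2) `^ (d.+1%:R / 2))^-1)%:E)%E.
Proof.
rewrite kleinE/= enorm_sqr => y0.
transitivity (\int[@lebesgue_measure R]_(z in `[0%R, +oo[)
    (z ^+ d * expR (- (z ^+ 2 * (1 + k * sqnorm y)) / 2))%:E)%E.
  apply: eq_integral => z; rewrite inE/= in_itv/= andbT => z0.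
  by rewrite /laplace_kernel/= ger0_norm.
rewrite gauss_moment_scale// muleC; congr (_ * (_^-1)%:E)%E.
by rewrite [d.+1%:R / 2]mulrC powRrM powR12_sqrt ?ltW// powR_mulrn// sqrtr_ge0.
Qed.

Lemma integral_box_setI_klein (R : realType) d (k : R) (a b : 'I_d -> R)
    (i : 'I_d) (f : 'rV[R]_d -> \bar R) :
  (forall j, 0 < a j) -> (forall j, 0 < b j) ->
  box (fun j => - a j) b `<=` klein_closure k ->
  measurable_fun (box (fun j => - a j) b) f ->
  (forall y, 0 <= f y)%E ->
  (\int[lebesgue_rV d]_(y in box (fun j => - a j)%R b) f y =
   \int[lebesgue_rV d]_(y in box (fun j => - a j)%R b `&` klein k) f y)%E.
Proof.
move=> a0 b0 Pk mf f0.
have null := box_minus_klein_null i a0 b0 Pk.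
rewrite (ge0_negligible_integral _ _ mf _ null)//; last 2 first.
- by apply: measurableD; [exact: measurable_box|exact: measurable_klein].
- exact: measurable_box.
by rewrite setDD.
Qed.

(** Both sides are the integral of [laplace_kernel] over the product of the
    half-line and the box, integrated in the two possible orders. *)
Lemma integral_slab_product (R : realType) d (k : R) (a b : 'I_d -> R)
    (i : 'I_d) :
  (forall j, 0 < a j) -> (forall j, 0 < b j) ->
  box (fun j => - a j) b `<=` klein_closure k ->
  (\int[@lebesgue_measure R]_(z in `[0%R, +oo[) (slab_product k a b z)%:E =
   gauss_moment R d * Vol k (box (fun j => - a j)%R b))%E.
Proof.
move=> a0 b0 Pk; set P := box _ _.
have mJ : measurable_fun setT (EFin \o @laplace_kernel R d k).
  by apply: measurable_fun_EFin; exact: measurable_laplace_kernel.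
have J0 p : (0 <= (EFin \o @laplace_kernel R d k) p)%E.
  by rewrite lee_fin laplace_kernel_ge0.
transitivity (\int[@lebesgue_measure R]_(z in `[0%R, +oo[)
    \int[lebesgue_rV d]_(y in P) (EFin \o @laplace_kernel R d k) (z, y))%E.
  by apply: eq_integral => z _; rewrite -integral_box_laplace_kernel.
rewrite fubini_tonelli_in//; last exact: measurable_box.
rewrite (integral_box_setI_klein i a0 b0 Pk); last 2 first.
- by apply: measurable_funTS; exact: measurable_integral_in.
- by move=> y; apply: integral_ge0 => z _; exact: J0.
have mPk : measurable (P `&` klein k).
  by apply: measurableI; [exact: measurable_box|exact: measurable_klein].
rewrite /Vol -/P -ge0_integralZl//; last 3 first.
- apply: measurable_funTS; apply: measurable_fun_EFin.
  exact: measurable_klein_density.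
- by move=> y _; rewrite lee_fin invr_ge0 powR_ge0.
- by rewrite ltW// gauss_moment_gt0.
apply: eq_integral => y; rewrite inE => -[_ ky].
exact: integral_laplace_kernel.
Qed.

(** For [0 <= k] each segment integral is bounded and the Gaussian dominates. For
    [k < 0] the hypothesis on the box, used at its farthest vertex, shows that the
    growth of the segment integrals is at most that of [expR (z ^+ 2 / 2)], and the
    remaining decay [z ^- d] is integrable because [2 <= d]. *)
Lemma slab_product_le (R : realType) d (k : R) (a b : 'I_d -> R) :
  (2 <= d)%N -> (forall j, 0 < a j) -> (forall j, 0 < b j) ->
  box (fun j => - a j) b `<=` klein_closure k ->
  exists C : R, forall z, 0 <= z -> slab_product k a b z <= C * (oneDsqr z)^-1.
Proof.
move=> d2 a0 b0 Pk; have [k0|k0] := leP 0 k.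
  have [C C0 HC] := exprn_expR_le R d.
  exists ((\prod_(j < d) (a j + b j)) * C) => z z0.
  apply: (@le_trans _ _
      ((\prod_(j < d) (z * (a j + b j))) * expR (- z ^+ 2 / 2))).
    rewrite ler_wpM2r ?expR_ge0//; apply: ler_prod => j _.
    rewrite ger0_norm// mulr_ge0 ?gauss_slab_ge0//= ler_wpM2l//.
    by rewrite gauss_slab_le// mulNr oppr_le0 divr_ge0// mulr_ge0// sqr_ge0.
  rewrite big_split/= prodr_const card_ord mulrAC [leLHS]mulrC -[leRHS]mulrA.
  rewrite ler_wpM2l ?HC//; apply: prodr_ge0 => j _.
  by rewrite addr_ge0// ltW.
(* m is the vector of absolute values of the vertex v farthest from 0. *)
pose m j := Num.max (a j) (b j).
pose l := - k.
have l0 : 0 < l by rewrite oppr_gt0.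
have lm : l * (\sum_j m j ^+ 2) <= 1.
  pose v : 'rV[R]_d := \row_j (if b j <= a j then - a j else b j).
  have Pv : box (fun j => - a j) b v.
    move=> j; rewrite mxE; case: ifP => _; rewrite lexx ?andbT/=.
      by rewrite (@le_trans _ _ 0)// ?oppr_le0 ltW.
    by rewrite (@le_trans _ _ 0)// ?oppr_le0 ltW.
  have := klein_closure_le (Pk _ Pv).
  rewrite (_ : sqnorm v = \sum_j m j ^+ 2); first by rewrite /l; lra.
  by apply: eq_bigr => j _; rewrite mxE /m; case: leP => _; rewrite ?sqrrN.
pose B j := a j + b j + 2 / l * ((a j)^-1 + (b j)^-1).
have B0 j : 0 <= B j.
  by rewrite /B !addr_ge0 ?mulr_ge0 ?addr_ge0 ?divr_ge0 ?invr_ge0 ?ltW.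
exists (\prod_(j < d) B j) => z z0.
(* w is made opaque so that big_split below does not split the quotient. *)
have [w wE] : exists w, w = z / oneDsqr z by eexists.
have w0 : 0 <= w by rewrite wE divr_ge0// ltW// oneDsqr_gt0.
have w1 : w <= 1.
  by rewrite wE ler_pdivrMr ?oneDsqr_gt0// mul1r /oneDsqr; nra.
apply: (@le_trans _ _
    ((\prod_(j < d) (B j * expR (l * z ^+ 2 / 2 * m j ^+ 2) * w)) *
    expR (- z ^+ 2 / 2))).
  rewrite ler_wpM2r ?expR_ge0//; apply: ler_prod => j _.
  rewrite ger0_norm// mulr_ge0 ?gauss_slab_ge0//=.
  rewrite -mulNr wE; apply: gauss_slab_decay => //.
    by rewrite a0/= /m le_max lexx.
  by rewrite b0/= /m le_max lexx orbT.
rewrite !big_split/= -expR_sum prodr_const card_ord -[leLHS]mulrA -[leLHS]mulrA.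
rewrite ler_wpM2l ?prodr_ge0//.
rewrite [leLHS]mulrCA -expRD -[leRHS]mulr1; apply: ler_pM => //.
- by rewrite exprn_ge0.
- apply: (@le_trans _ _ (w ^+ 2)); first exact: ler_wiXn2l.
  rewrite -[leRHS]mul1r expr2 ler_pdivlMr ?oneDsqr_gt0// wE.
  rewrite [leLHS](_ : _ = z * z / oneDsqr z); last first.
    by field; rewrite gt_eqF// oneDsqr_gt0.
  by rewrite ler_pdivrMr ?oneDsqr_gt0// mul1r /oneDsqr; nra.
- rewrite expR_le1 -mulr_sumr; have := sqr_ge0 z.
  by move: lm; set S := \sum_j _; nra.
Qed.

(** * The volume formula *)

Lemma cintegral_scaled_real (R : realType) (D : set R) (c : R[i]) (h : R -> R)
    (f : R -> R[i]) : measurable (D : set (measurableTypeR R)) ->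
  (@lebesgue_measure R).-integrable D (EFin \o h) ->
  (forall z, D z -> f z = c * (h z)%:C) ->
  cintegrable D f /\
  cintegral D f = c * (\int[@lebesgue_measure R]_(z in D) h z)%:C.
Proof.
case: c => c1 c2 mD ih fE.
have reE z : z \in D -> complex.Re (f z) = c1 * h z.
  by rewrite inE => /fE ->; simpc.
have imE z : z \in D -> complex.Im (f z) = c2 * h z.
  by rewrite inE => /fE ->; simpc.
have ic (r : R) :
    (@lebesgue_measure R).-integrable D (EFin \o (fun z => r * h z)).
  by have := integrableZl mD r ih; apply: eq_integrable.
split.
  split.
    by apply: eq_integrable (ic c1) => // z zD /=; rewrite reE.
  by apply: eq_integrable (ic c2) => // z zD /=; rewrite imE.
have -> : cintegral D f =
    (c1 * \int[@lebesgue_measure R]_(z in D) h z) +i*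
    (c2 * \int[@lebesgue_measure R]_(z in D) h z).
  by congr (_ +i* _); rewrite -RintegralZl//; exact: eq_Rintegral.
by simpc.
Qed.

Lemma Gamma_half (R : realType) n :
  Gamma (n.+2%:R / 2 : R) = (Num.sqrt 2 ^+ n)^-1 * fine (gauss_moment R n.+1).
Proof.
by rewrite /Gamma /Rintegral Gamma_gauss_moment fineM// gauss_moment_fin_num.
Qed.

(** All constants cancel: the Gamma function in [omega] against the moment coming
    from the radial integral, leaving one factor [sqrt (2 * pi)] per coordinate and
    one for the radial variable. *)
Lemma omega_gauss_moment (R : realType) n : (0 < n)%N ->
  @omega R n.+1 * fine (gauss_moment R n) = Num.sqrt (2 * pi) ^+ n.+1.
Proof.
case: n => // n _; rewrite /omega Gamma_half.
have M0 : fine (gauss_moment R n.+1) != 0.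
  rewrite gt_eqF// fine_gt0// gauss_moment_gt0/= -ge0_fin_numE.
    exact: gauss_moment_fin_num.
  by rewrite ltW// gauss_moment_gt0.
rewrite [n.+2%:R / 2]mulrC powRrM powR12_sqrt ?pi_ge0// powR_mulrn ?sqrtr_ge0//.
rewrite sqrtrM// exprMn -[n.+2 in RHS]addn2 exprD sqr_sqrtr//.
rewrite addn2 invfM invrK mulrA mulfVK//.
by rewrite mulrC mulrA.
Qed.

Unset Implicit Arguments.
Set Strict Implicit.

Theorem theorem3p2 (R : realType) (d : nat) (kappa : R) (tm tp : 'I_d -> R) :
  (2 <= d)%N -> kappa != 0 ->
  (forall j, 0 < tm j) -> (forall j, 0 < tp j) ->
  let P : set 'rV[R]_d := box (fun j => - tm j) tp in
  P `<=` klein_closure kappa ->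
  let F : R -> R[i] := fun z =>
    (\prod_(j < d) (Phi ((tp j)%:C * csqrt kappa * z%:C)
                    - Phi (- (tm j)%:C * csqrt kappa * z%:C)))
    * (expR (- z ^+ 2 / 2))%:C in
  [/\ cintegrable `[0, +oo[ F,
      Vol kappa P \is a fin_num &
      (fine (Vol kappa P))%:C =
        (omega d.+1)%:C / (csqrt kappa ^+ d * (Num.sqrt (2 * pi))%:C)
        * cintegral `[0, +oo[ F].
Proof.
move=> d2 k0 tm0 tp0 P Pk F.
pose i : 'I_d := Ordinal (ltnW d2).
pose s : R := Num.sqrt (2 * pi).
have s0 : s != 0 by rewrite gt_eqF// sqrtr_gt0 mulr_gt0// pi_gt0.
pose M := fine (gauss_moment R d).
have ME : gauss_moment R d = M%:E by rewrite fineK// gauss_moment_fin_num.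
have M0 : 0 < M by rewrite -lte_fin -ME gauss_moment_gt0.
have IG := integral_slab_product i tm0 tp0 Pk.
have mG := measurable_slab_product kappa tm tp.
have [C HC] := slab_product_le d2 tm0 tp0 Pk.
have finG : (\int[@lebesgue_measure R]_(z in `[0%R, +oo[)
    (slab_product kappa tm tp z)%:E < +oo)%E.
  apply: (@integral_oneDsqr_lty _ C) => // z z0.
  by rewrite slab_product_ge0 HC.
have V0 : (0 <= Vol kappa P)%E.
  by apply: integral_ge0 => y _; rewrite lee_fin invr_ge0 powR_ge0.
have finV : Vol kappa P \is a fin_num.
  (* A positive multiple of the volume is the finite radial integral. *)
  rewrite ge0_fin_numE//; move: finG; rewrite IG ME -/P.
  by move: V0; case: (Vol kappa P) => [v _ _|_|//]; rewrite ?ltry// gt0_muley.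
have iG : (@lebesgue_measure R).-integrable `[0, +oo[
    (EFin \o slab_product kappa tm tp).
  apply/integrableP; split.
    by apply/measurable_EFinP; exact: measurable_funTS.
  rewrite [ltLHS](_ : _ = \int[@lebesgue_measure R]_(z in `[0%R, +oo[)
      (slab_product kappa tm tp z)%:E)%E//.
  by apply: eq_integral => z _ /=; rewrite ger0_norm// slab_product_ge0.
have FE z : `[0, +oo[%classic z ->
    F z = csqrt kappa ^+ d * (s^-1 ^+ d)%:C * (slab_product kappa tm tp z)%:C.
  rewrite /= in_itv/= andbT => z0; rewrite /F /slab_product ger0_norm//.
  under eq_bigr do rewrite Phi_diff_gauss_slab//.
  rewrite big_split/= prodr_const card_ord -!mulrA; congr (_ * _).
  rewrite -rmorph_prod -!rmorphM/=; congr (_%:C).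
  by rewrite [in LHS]big_split/= prodr_const card_ord -[LHS]mulrA.
have [iF ->] := cintegral_scaled_real (measurable_itv _) iG FE.
split=> //.
rewrite /Rintegral IG -/P ME fineM//=; set v := fine (Vol _ _).
have cs0 : csqrt kappa ^+ d != 0 by rewrite expf_neq0// csqrt_neq0.
have {1}-> : v = omega d.+1 / s * (s^-1 ^+ d * (M * v)).
  transitivity (omega d.+1 * M * (s^-1 ^+ d.+1) * v); last first.
    by rewrite exprS; ring.
  rewrite omega_gauss_moment; last exact: ltnW.
  by rewrite exprVn divff ?mul1r// expf_neq0.
move: (omega _) => w; rewrite !rmorphM/= fmorphV/= -/s; field.
by rewrite fmorph_eq0 s0 cs0.
Qed.
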